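(* Let $1<p<\infty$, $1/p+1/q=1$, and let $Z=\{z_k\}_{k\ge0}$ be a sequence of distinct nonzero points in $\mathbb{D}$. For any $j\ge0$, $f_j$ exists if and only if $\lim_{N\to\infty}\|f_{j,N}\|_p<\infty$. In this case, $f_{j,N}$ converges in norm to $f_j$ in $\ell^p_A$ as $N\to\infty$.
   Context: $\mathbb{D}$ is the open unit disk in $\mathbb{C}$. $\ell^p_A$ is the space of analytic functions $f(z)=\sum_{n\ge0}a_nz^n$ on $\mathbb{D}$ with $\|f\|_p:=(\sum_n|a_n|^p)^{1/p}<\infty$. For $N\in\mathbb{N}$ and $0\le j\le N$, $f_{j,N}$ is the (unique) function in $\ell^p_A$ of minimum norm such that $(1-|z_j|^q)^{1/q}f_{j,N}(z_j)=1$ and $(1-|z_k|^q)^{1/q}f_{j,N}(z_k)=0$ for all $0\le k\le N$, $k\ne j$. $f_j$ is the function in $\ell^p_A$ of minimum norm such that $(1-|z_j|^q)^{1/q}f_j(z_j)=1$ and $(1-|z_k|^q)^{1/q}f_j(z_k)=0$ for all $k\ne j$; it need not exist in general, and it exists (uniquely) exactly when some function in $\ell^p_A$ satisfies these conditions. *)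

(* Defs.v *)
From mathcomp Require Import all_boot all_order all_algebra.
From mathcomp Require Import complex.
From mathcomp Require Import all_classical all_reals all_analysis.

Set Implicit Arguments.
Unset Strict Implicit.
Unset Printing Implicit Defensive.

Import Order.TTheory GRing.Theory Num.Theory.
Import numFieldNormedType.Exports.

Local Open Scope classical_set_scope.
Local Open Scope complex_scope.
Local Open Scope ring_scope.

(* An analytic function on the unit disk is represented by its sequence of
   Taylor coefficients [a : nat -> R[i]]; the two determine each other, and
   coefficients in l^p (indeed, bounded ones) always give a power series that
   converges on the disk. [Normc.normc] is the real-valued modulus. *)
Section lpA.
Context {R : realType}.
Implicit Types (p q : R) (a : nat -> R[i]) (z : R[i]) (Z : nat -> R[i]).

Definition lpnorm p a : \bar R :=
  ((\sum_(0 <= n <oo) ((Normc.normc (a n)) `^ p)%:E) `^ p^-1)%E.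

Definition lpA p : set (nat -> R[i]) := [set a | (lpnorm p a < +oo)%E].

(* [R[i]^o] carries the usual topology of the complex plane. *)
Definition eval a z : R[i] :=
  limn (series (fun n => a n * z ^+ n : R[i]^o)).

Definition weight q z : R[i] := ((1 - Normc.normc z `^ q) `^ q^-1)%:C.

Definition interpolants p q Z (j : nat) (K : set nat) : set (nat -> R[i]) :=
  [set a | [/\ lpA p a,
               weight q (Z j) * eval a (Z j) = 1 &
               forall k, K k -> k <> j -> weight q (Z k) * eval a (Z k) = 0]].

Definition min_norm p (A : set (nat -> R[i])) : set (nat -> R[i]) :=
  [set a | A a /\ forall b, A b -> (lpnorm p a <= lpnorm p b)%E].

(* The minimal-norm interpolant on z_0, ..., z_N. It is meant for j <= N; when
   N < j the node z_j is imposed in addition to z_0, ..., z_N. *)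
Definition fjN p q Z (j N : nat) : nat -> R[i] :=
  xget 0 (min_norm p (interpolants p q Z j [set k | (k <= N)%N])).

Definition is_fj p q Z (j : nat) a : Prop :=
  min_norm p (interpolants p q Z j setT) a.

End lpA.

(* Main.v *)
Require Import Defs.
From mathcomp Require Import all_boot all_order all_algebra.
From mathcomp Require Import complex.
From mathcomp Require Import all_classical all_reals all_analysis.
From mathcomp Require Import ring lra.

(** ** Why the theorem holds

The space of coefficient sequences with finite p-norm is uniformly convex, and
this is used in a form that is additive over the coefficients: for every
[e > 0] there is [C >= 0] such that
[[
  |x - y|^p + C |(x + y)/2|^p <= (e + C/2) (|x|^p + |y|^p)
]]
for all complex [x] and [y] ([uniform_convexity_complex]).  Summing over the
coefficients, the same inequality holds for the energy, the sum of the p-th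
powers of the moduli ([energy_uniform_convexity]).  It covers all exponents
[p > 1] at once, and all estimates are made on the energy, which orders the
sequences as the norm does.

Let [C_0], [C_1], ... be sets of sequences closed under midpoints, and let [a_N]
lie in [C_n] for all large [N], with energies that tend to [mu] while every
element of [C_n] has energy almost [mu] at least.  The midpoint of [a_N] and
[a_M] then has energy almost [mu], and the inequality forces the energy of
[a_N - a_M] to be small: the sequence is Cauchy, hence converges
([minimizing_cvg]).  This one statement is used three times:
- with all [C_n] equal and a minimizing sequence, it yields minimal
  interpolants ([min_norm_exists]);
- with all [C_n] equal and two minimizers taken alternately, it yields their
  uniqueness ([min_norm_unique]);
- with [C_N] the interpolants on the first nodes, which decrease with [N], and
  [a_N = f_{j,N}], it yields the convergence of [f_{j,N}] when the norms are
  bounded ([bounded_fjN_cvg]).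

The limits are interpolants because evaluation at a point of the disk is
continuous: coefficients bounded by [B] give values bounded by [B / (1 - |z|)]
([eval_bound]).  In the last case the limit interpolates at all nodes, and it is
minimal because its energy is at most the supremum of the energies of the
[f_{j,N}], each of which is at most that of any interpolant at all nodes.
Conversely an interpolant at all nodes bounds all the norms of the [f_{j,N}],
which increase with [N]. *)

Set Implicit Arguments.
Unset Strict Implicit.
Unset Printing Implicit Defensive.

Import Order.TTheory GRing.Theory Num.Theory.
Import numFieldNormedType.Exports.

Local Open Scope classical_set_scope.
Local Open Scope complex_scope.
Local Open Scope ring_scope.

(** * A uniform strict convexity of the p-th power *)

Section S.
Context {R : realType}.
Implicit Types (p u e : R).

(** With [L = ln x] and [x ^ p = x * exp ((p - 1) L)], the bound [1 + t <= exp t]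
reduces the claim to [x ln x > x - 1], which is [exp (- L) > 1 - L]; that
inequality is strict because [L] is nonzero. *)
Lemma powR_gt_tangent p x : 1 < p -> 0 < x -> x != 1 ->
  1 + p * (x - 1) < x `^ p.
Proof.
move=> p1 x0 x1; set L := ln x.
have L0 : L != 0 by rewrite ln_eq0.
have xE : x = expR L by rewrite lnK // posrE.
have h1 : 1 + (p - 1) * L <= expR ((p - 1) * L) by exact: expR_ge1Dx.
have h2 : 1 - L < x^-1 by rewrite xE -expRN; apply: expR_gt1Dx; rewrite oppr_eq0.
have h3 : x - x * L < 1.
  by have := ltr_pM2l x0 (1 - L) x^-1; rewrite h2 mulfV ?gt_eqF// mulrBr mulr1.
have -> : x `^ p = x * expR ((p - 1) * L).
  rewrite /powR gt_eqF// -/L {1}xE -expRD; congr expR; ring.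
apply: (@lt_le_trans _ _ (x * (1 + (p - 1) * L))); last by rewrite ler_pM2l.
nra.
Qed.

Lemma powR_ge_tangent p x : 1 < p -> 0 <= x -> 1 + p * (x - 1) <= x `^ p.
Proof.
move=> p1; rewrite le_eqVlt => /predU1P[<-|x0].
  rewrite powR0 ?gt_eqF ?(lt_trans ltr01)//; lra.
have [->|x1] := eqVneq x 1; first by rewrite powR1; lra.
exact/ltW/powR_gt_tangent.
Qed.

(** The tangent of the convex function [u |-> (1 + u) ^ p] at [v] has slope
[p (1 + v) ^ (p - 1)], which is at least [p].  Hence the excess of [(1 + u) ^ p]
over its tangent [1 + p u] at [0] only grows beyond [v]. *)
Lemma powR_tangent_excess p v u : 1 < p -> 0 <= v -> v <= u ->
  (1 + v) `^ p + p * (u - v) <= (1 + u) `^ p.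
Proof.
move=> p1 v0 vu; have w0 : 0 < 1 + v by lra.
have -> : 1 + u = (1 + v) * ((1 + u) / (1 + v)) by field; rewrite gt_eqF.
have d0 : 0 <= (1 + u) / (1 + v) by apply: divr_ge0; lra.
rewrite powRM ?(ltW w0)//.
apply: (@le_trans _ _ ((1 + v) `^ p * (1 + p * ((1 + u) / (1 + v) - 1)))); last first.
  by rewrite ler_pM2l ?powR_gt0// powR_ge_tangent.
rewrite [leRHS]mulrDr mulr1 lerD2l.
have -> : (1 + u) / (1 + v) - 1 = (u - v) / (1 + v) by field; rewrite gt_eqF.
have -> : p * (u - v) = (1 + v) * (p * ((u - v) / (1 + v))) by field; rewrite gt_eqF.
apply: ler_wpM2r.
  by rewrite mulr_ge0 ?divr_ge0 ?subr_ge0 ?(ltW w0)//; lra.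
by rewrite -{1}(powRr1 (ltW w0)); apply: ler_powR; lra.
Qed.

(** Two nonnegative reals of mean 1 are written [1 - u] and [1 + u]; [M] and [D] stand
for the moduli of the half sum and of the half difference of complex numbers
with those moduli.  If [D] is not small, one of two things makes [T - M ^ p]
larger than a positive constant: either [u] is not small, and strict convexity
makes [T] exceed 1; or [u] is small, and the parallelogram identity
pushes [M] below 1. *)
Lemma uniform_convexity_midpoint1 p e : 1 < p -> 0 < e ->
  exists2 C, 0 <= C & forall u M D : R, 0 <= u <= 1 -> 0 <= M <= 1 -> 0 <= D ->
    M ^+ 2 + D ^+ 2 = 1 + u ^+ 2 ->
    let T := ((1 - u) `^ p + (1 + u) `^ p) / 2 in
    1 <= T /\ (2 * D) `^ p <= e + C * (T - M `^ p).
Proof.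
move=> p1 e0.
(* [2 * D > 2 * r] is what remains once [(2 * D) `^ p <= e] is excluded. *)
pose r := e `^ p^-1 / 2; have r0 : 0 < r by rewrite divr_gt0// powR_gt0.
pose v := r / 2.
(* [c] bounds [T - 1] from below when [v <= u]. *)
pose c := ((1 + v) `^ p - (1 + p * v)) / 2.
have c0 : 0 < c.
  rewrite divr_gt0// subr_gt0; have := @powR_gt_tangent p (1 + v) p1.
  rewrite [1 + v - 1]addrC addKr.
  by apply; [|rewrite -subr_eq0 addrC addKr gt_eqF]; rewrite /v; lra.
(* [D ^+ 2 <= 2] gives [2 * D <= 3], so [B] bounds the left-hand side. *)
pose B : R := 3 `^ p; have B0 : 0 <= B by exact: powR_ge0.
pose m := Num.min c (r ^+ 2 / 4).
have m0 : 0 < m by rewrite lt_min c0 divr_gt0// exprn_gt0.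
exists (B / m); first by rewrite divr_ge0// ltW.
move=> u M D /andP[u0 u1] /andP[M0 M1] D0 MD T.
have h1 : 1 - p * u <= (1 - u) `^ p.
  by have := @powR_ge_tangent p (1 - u) p1; rewrite subr_ge0 => /(_ u1); lra.
have T1 : 1 <= T.
  by rewrite /T; have := @powR_ge_tangent p (1 + u) p1 (addr_ge0 ler01 u0); lra.
have Mp : M `^ p <= M.
  move: M0; rewrite le_eqVlt => /predU1P[<-|M0].
    by rewrite powR0 // gt_eqF // (lt_trans ltr01).
  by rewrite -[leRHS](powRr1 (ltW M0)); apply: ger_powR; [apply/andP; split|exact: ltW].
split=> //; have [De|De] := leP ((2 * D) `^ p) e.
  apply: (le_trans De); rewrite lerDl mulr_ge0 ?divr_ge0 ?(ltW m0)//; lra.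
have DB : (2 * D) `^ p <= B.
  apply: ge0_ler_powR; rewrite ?nnegrE; [lra|lra|lra|]; nra.
have rD : r < D.
  rewrite ltNge; apply/negP => Dr; move: De; apply/negP; rewrite -leNgt.
  have -> : e = (2 * r) `^ p.
    by rewrite /r mulrC divfK// -powRrM mulVf ?powRr1 ?(ltW e0)// gt_eqF; lra.
  by apply: ge0_ler_powR; rewrite ?nnegrE; lra.
suff hm : m <= T - M `^ p.
  rewrite (le_trans DB)// -[leLHS](@divfK _ m) ?gt_eqF//.
  rewrite (@le_trans _ _ (B / m * (T - M `^ p)))//; last lra.
  by rewrite ler_wpM2l// divr_ge0// ltW.
have [vu|uv] := leP v u.
  apply: (@le_trans _ _ c); first by rewrite ge_min lexx.
  have := @powR_tangent_excess p v u p1 _ vu; rewrite /c /T /v; lra.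
apply: (@le_trans _ _ (r ^+ 2 / 4)); first by rewrite ge_min lexx orbT.
suff : M <= 1 - r ^+ 2 / 4 by lra.
rewrite /v in uv; nra.
Qed.

(** Every term is homogeneous of degree [p], so dividing by the mean of [s] and [t]
reduces to mean 1. *)
Lemma uniform_convexity_real p e : 1 < p -> 0 < e ->
  exists2 C, 0 <= C & forall s t M D : R, 0 <= s -> 0 <= t -> 0 <= M -> 0 <= D ->
    M <= (s + t) / 2 -> M ^+ 2 + D ^+ 2 = (s ^+ 2 + t ^+ 2) / 2 ->
    (2 * D) `^ p <= e * (s `^ p + t `^ p) + C * ((s `^ p + t `^ p) / 2 - M `^ p).
Proof.
move=> p1 e0; have [C C0 HC] := uniform_convexity_midpoint1 p1 e0.
exists C => // s t M D; wlog st : s t / s <= t.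
  move=> H s0 t0; have [st|ts] := leP s t; first exact: H.
  by rewrite [s + t]addrC [s ^+ 2 + _]addrC [s `^ p + _]addrC; apply: H; rewrite // ltW.
move=> s0 t0 M0 D0 Mm MD.
have p0 : p != 0 by rewrite gt_eqF// (lt_trans ltr01).
have [t00|t_neq0] := eqVneq t 0.
  have s00 : s = 0 by apply/eqP; rewrite eq_le s0 -t00 st.
  have M00 : M = 0 by move: Mm; rewrite s00 t00; lra.
  have D00 : D = 0 by move: MD; rewrite s00 t00 M00; nra.
  by rewrite s00 t00 M00 D00 mulr0 powR0// addr0 !mul0r subrr !mulr0 addr0.
have {}t0 : 0 < t by rewrite lt_neqAle eq_sym t_neq0.
pose m := (s + t) / 2; have m0 : 0 < m by rewrite /m; lra.
have mn0 : m != 0 by rewrite gt_eqF.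
pose u := (t - s) / 2 / m.
have sE : s = m * (1 - u) by rewrite /u /m; field; move: mn0; rewrite /m; lra.
have tE : t = m * (1 + u) by rewrite /u /m; field; move: mn0; rewrite /m; lra.
have u0 : 0 <= u by rewrite divr_ge0 ?(ltW m0)//; lra.
have u1 : u <= 1 by rewrite ler_pdivrMr// /m; lra.
have ME : M = m * (M / m) by rewrite mulrC divfK.
have DE : D = m * (D / m) by rewrite mulrC divfK.
have Mm0 : 0 <= M / m by rewrite divr_ge0// ltW.
have Dm0 : 0 <= D / m by rewrite divr_ge0// ltW.
have Mm1 : M / m <= 1 by rewrite ler_pdivrMr// mul1r.
have MDm : (M / m) ^+ 2 + (D / m) ^+ 2 = 1 + u ^+ 2.
  apply: (@mulfI _ (m ^+ 2)); first by rewrite expf_neq0.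
  by rewrite mulrDr -!exprMn -ME -DE MD sE tE; field.
have [||T1 H] := HC u (M / m) (D / m) _ _ Dm0 MDm; rewrite ?u0 ?Mm0//.
have mp0 : 0 < m `^ p by rewrite powR_gt0.
move: H; rewrite -(ler_pM2l mp0) => H.
have -> : (2 * D) `^ p = m `^ p * (2 * (D / m)) `^ p.
  rewrite -powRM; [by rewrite {1}DE mulrCA | exact: ltW | by rewrite mulr_ge0].
have -> : s `^ p = m `^ p * (1 - u) `^ p.
  by rewrite {1}sE powRM ?(ltW m0) ?subr_ge0.
have -> : t `^ p = m `^ p * (1 + u) `^ p.
  by rewrite {1}tE powRM ?(ltW m0)// addr_ge0.
have -> : M `^ p = m `^ p * (M / m) `^ p by rewrite {1}ME powRM// ltW.
apply: (le_trans H); rewrite -subr_ge0.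
set a := _ `^ p in T1 *; set b := (1 + u) `^ p in T1 *; set c := (M / m) `^ p.
rewrite (_ : _ - _ = m `^ p * e * (a + b - 1)); last by field.
by rewrite !mulr_ge0 ?(ltW mp0) ?(ltW e0)//; lra.
Qed.

Implicit Types x y z : R[i].

Lemma normc_real (k : R) : Normc.normc k%:C = `|k|.
Proof. by rewrite /= expr0n addr0 sqrtr_sqr. Qed.

Lemma normc_ge0 x : 0 <= Normc.normc x.
Proof. by case: x => a b; rewrite sqrtr_ge0. Qed.

Lemma normr_normc x : `|x| = (Normc.normc x)%:C.
Proof. by case: x. Qed.

Lemma parallelogram x y : Normc.normc ((x + y) * (2^-1)%:C) ^+ 2 +
   (Normc.normc (x - y) / 2) ^+ 2 = (Normc.normc x ^+ 2 + Normc.normc y ^+ 2) / 2.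
Proof.
rewrite Normc.normcM normc_real ger0_norm ?invr_ge0//; case: x y => [a b] [c d] /=.
by rewrite !exprMn !sqr_sqrtr ?addr_ge0 ?sqr_ge0//; field.
Qed.

(** The real inequality applies to the moduli of [x], [y], the half sum and the half
difference, which are related by the parallelogram identity. *)
Lemma uniform_convexity_complex p e : 1 < p -> 0 < e ->
  exists2 C, 0 <= C & forall x y,
    Normc.normc (x - y) `^ p + C * Normc.normc ((x + y) * (2^-1)%:C) `^ p <=
    (e + C / 2) * (Normc.normc x `^ p + Normc.normc y `^ p).
Proof.
move=> p1 e0; have [C C0 H] := uniform_convexity_real p1 e0.
exists C => // x y.
have := H (Normc.normc x) (Normc.normc y)
  (Normc.normc ((x + y) * (2^-1)%:C)) (Normc.normc (x - y) / 2).
rewrite parallelogram !normc_ge0 divr_ge0 ?normc_ge0// => /(_ isT isT isT isT _ erefl).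
rewrite {1}Normc.normcM normc_real ger0_norm ?invr_ge0// ler_pM2r ?invr_gt0//.
move=> /(_ (le_normcD _ _)); rewrite mulrCA mulfV// mulr1; lra.
Qed.

(** * The energy of a coefficient sequence *)

Implicit Types (a b f g : nat -> R[i]).

(** The p-th power of the norm.  It is additive over the coefficients, so pointwise
inequalities pass to it by summation. *)
Definition energy p a : \bar R :=
  (\sum_(0 <= n <oo) (Normc.normc (a n) `^ p)%:E)%E.

Definition cvg_energy p (a : nat -> nat -> R[i]) g : Prop :=
  forall e, 0 < e -> exists n0, forall N, (n0 <= N)%N ->
    (energy p (a N - g)%R <= e%:E)%E.

Definition mid a b : nat -> R[i] := fun n => (a n + b n) * (2^-1)%:C.

Lemma energy_ge0 p a : (0 <= energy p a)%E.
Proof. by apply: nneseries_ge0 => n _ _; rewrite lee_fin powR_ge0. Qed.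

Lemma lpnormK p a : 0 < p -> (lpnorm p a `^ p)%E = energy p a.
Proof.
by move=> p0; rewrite /lpnorm -poweRrM mulVf ?gt_eqF// poweRe1 ?energy_ge0.
Qed.

Lemma le_lpnorm p a b : 0 < p ->
  (lpnorm p a <= lpnorm p b)%E = (energy p a <= energy p b)%E.
Proof.
move=> p0; apply/idP/idP => ab.
  rewrite -!(lpnormK _ p0); apply: gt0_ler_poweR => //; first exact: ltW.
    by rewrite in_itv/= leey andbT poweR_ge0.
  by rewrite in_itv/= leey andbT poweR_ge0.
apply: gt0_ler_poweR => //; first by rewrite invr_ge0 ltW.
  by rewrite in_itv/= leey andbT energy_ge0.
by rewrite in_itv/= leey andbT energy_ge0.
Qed.

Lemma lpAE p a : 0 < p -> lpA p a <-> (energy p a < +oo)%E.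
Proof.
move=> p0; split; rewrite /lpA/= => h; first by rewrite -lpnormK// poweR_lty.
exact: poweR_lty.
Qed.

Lemma energy_uniform_convexity p e : 1 < p -> 0 < e ->
  exists2 C, 0 <= C & forall a b,
    (energy p (a - b)%R + C%:E * energy p (mid a b) <=
     (e + C / 2)%:E * (energy p a + energy p b))%E.
Proof.
move=> p1 e0; have [C C0 H] := uniform_convexity_complex p1 e0.
exists C => // a b.
have P (u : nat -> R[i]) n : (0 <= (Normc.normc (u n) `^ p)%:E)%E.
  by rewrite lee_fin powR_ge0.
rewrite /energy.
rewrite -nneseriesZl// -nneseriesD//; last first.
  by move=> n _ _; rewrite mule_ge0// ?lee_fin.
rewrite -nneseriesD// -nneseriesZl//; last by move=> n _; rewrite adde_ge0.
apply: lee_nneseries => [n _ _|n _]; first by rewrite adde_ge0// mule_ge0// lee_fin.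
by rewrite lee_fin; exact: H.
Qed.

(** Bounds every coefficient by the norm: this is how convergence in energy becomes
convergence of coefficients, and how finite energy gives bounded coefficients. *)
Lemma energy_coef p a n c : 0 < p -> (energy p a <= c%:E)%E ->
  Normc.normc (a n) <= c `^ p^-1.
Proof.
move=> p0 ac.
have : ((Normc.normc (a n) `^ p)%:E <= c%:E)%E.
  apply: le_trans ac; rewrite /energy (@nneseriesD1 _ _ n)//; last first.
    by move=> k _; rewrite lee_fin powR_ge0.
  by rewrite leeDl// nneseries_ge0// => k _ _; rewrite lee_fin powR_ge0.
rewrite lee_fin => h.
have {1}-> : Normc.normc (a n) = (Normc.normc (a n) `^ p) `^ p^-1.
  by rewrite -powRrM mulfV ?gt_eqF// powRr1// normc_ge0.
apply: ge0_ler_powR => //; [by rewrite invr_ge0 ltW|by rewrite nnegrE powR_ge0|].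
by rewrite nnegrE (le_trans _ h)// powR_ge0.
Qed.

(** At positive points the power is differentiable.  At 0 it is not even continuous,
its values at negative reals being 1, so there the proof relies on [0 <= x n]. *)
Lemma cvg_powR p (x : nat -> R) (l : R) : 0 < p -> (forall n, 0 <= x n) ->
  x @ \oo --> l -> (fun n => x n `^ p) @ \oo --> l `^ p.
Proof.
move=> p0 x0 xl.
have : 0 <= l.
  by rewrite -(cvg_lim _ xl)//; apply: limr_ge; [apply/cvg_ex; exists l|exact: nearW].
rewrite le_eqVlt => /predU1P[l0|l0]; last first.
  have c : {for l, continuous ((@powR R)^~ p)}.
    apply: differentiable_continuous; apply/derivable1_diffP.
    by have [] := is_derive1_powR p l0.
  exact: (cvg_comp _ _ xl c).
rewrite -l0 powR0 ?gt_eqF//; apply/cvgrPdist_lt => e e0.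
have /cvgrPdist_lt/(_ (e `^ p^-1)) := xl; rewrite -l0 powR_gt0// => /(_ isT).
apply: filterS => n; rewrite !sub0r !normrN !ger0_norm ?powR_ge0// => h.
have -> : e = (e `^ p^-1) `^ p by rewrite -powRrM mulVf ?gt_eqF// powRr1// ltW.
by apply: gt0_ltr_powR; rewrite ?nnegrE ?powR_ge0.
Qed.

Lemma dist_normc x y : `|Normc.normc x - Normc.normc y| <= Normc.normc (x - y).
Proof.
rewrite ler_norml; apply/andP; split.
  have := le_normcD (y - x) x; rewrite subrK -(opprB x y) normcN; lra.
by have := le_normcD (x - y) y; rewrite subrK; lra.
Qed.

Lemma cvg_normc (x : nat -> R[i]) y : Normc.normc (x n - y) @[n --> \oo] --> 0 ->
  Normc.normc (x n) @[n --> \oo] --> Normc.normc y.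
Proof.
move=> /cvgrPdist_lt h; apply/cvgrPdist_lt => e e0; have := h e e0.
apply: filterS => n; rewrite sub0r normrN ger0_norm ?normc_ge0//.
by apply: le_lt_trans; rewrite distrC dist_normc.
Qed.

(** Lower semicontinuity of the energy: each partial sum is a continuous function of
finitely many coefficients, and the energy is the supremum of the partial
sums. *)
Lemma energy_fatou p (u : nat -> nat -> R[i]) g (c : R) : 0 < p ->
  (forall n, Normc.normc (u N n - g n) @[N --> \oo] --> 0) ->
  (\forall N \near \oo, energy p (u N) <= c%:E)%E ->
  (energy p g <= c%:E)%E.
Proof.
move=> p0 ug uc.
apply: lime_le.
  by apply: is_cvg_nneseries => n _ _; rewrite lee_fin powR_ge0.
apply: nearW => k; rewrite sumEFin lee_fin.
have h : (\sum_(0 <= n < k) Normc.normc (u N n) `^ p) @[N --> \oo] -->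
   \sum_(0 <= n < k) Normc.normc (g n) `^ p.
  apply: cvg_big => [|n _]; first exact: add_continuous.
  by apply: cvg_powR => [//|N|]; [exact: normc_ge0|exact: cvg_normc].
rewrite -(cvg_lim _ h)//; apply: limr_le; first by apply/cvg_ex; eexists; exact: h.
apply: filterS uc => N uNc; rewrite -lee_fin; apply: le_trans uNc.
rewrite -sumEFin; apply: nneseries_lim_ge => n _ _; by rewrite lee_fin powR_ge0.
Qed.

(** * Completeness and minimizing sequences *)

Lemma normc_le_ReIm x : Normc.normc x <= `|complex.Re x| + `|complex.Im x|.
Proof.
case: x => u v /=; rewrite -[leRHS]ger0_norm ?addr_ge0// -sqrtr_sqr ler_sqrt ?sqr_ge0//.
rewrite sqrrD !real_normK ?num_real// -addrA [X in _ <= _ + X]addrC addrA lerDl.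
by rewrite mulrn_wge0 ?mulr_ge0.
Qed.

Lemma Re_le_normc x : `|complex.Re x| <= Normc.normc x.
Proof. by case: x => u v /=; rewrite -sqrtr_sqr ler_wsqrtr// lerDl sqr_ge0. Qed.

Lemma Im_le_normc x : `|complex.Im x| <= Normc.normc x.
Proof. by case: x => u v /=; rewrite -sqrtr_sqr ler_wsqrtr// lerDr sqr_ge0. Qed.

Lemma cvg_ReIm (x : nat -> R[i]) (r s : R) :
  complex.Re (x n) @[n --> \oo] --> r -> complex.Im (x n) @[n --> \oo] --> s ->
  Normc.normc (x n - (r +i* s)) @[n --> \oo] --> 0.
Proof.
have dist0 (u : nat -> R) l : u @ \oo --> l -> `|u n - l| @[n --> \oo] --> 0.
  move=> ul; rewrite -[X in _ --> X](@normr0 _ R) -[X in `|X|](subrr l).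
  by apply: cvg_norm; apply: cvgB => //; exact: cvg_cst.
move=> xr xs; apply: (@squeeze_cvgr _ _ _ _ (cst 0)
  (fun n => `|complex.Re (x n) - r| + `|complex.Im (x n) - s|)).
- apply: nearW => n; rewrite normc_ge0/=.
  by rewrite (le_trans (normc_le_ReIm _))// !raddfB.
- exact: cvg_cst.
- by rewrite -[X in _ --> X]addr0; apply: cvgD; exact: dist0.
Qed.

Lemma real_cauchy_cvg (x : nat -> R) :
  (forall e, 0 < e -> exists n0, forall N M, (n0 <= N)%N -> (n0 <= M)%N ->
     `|x N - x M| <= e) ->
  exists l : R, x @ \oo --> l.
Proof.
move=> H; suff : cvgn x by move=> h; exists (limn x).
apply/cauchy_cvgP/cauchy_exP => e e0.
have [|n0 Hn] := H (e / 2); first by rewrite divr_gt0.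
exists (x n0), n0 => //= M /= h.
by rewrite /ball/= (le_lt_trans (Hn _ _ _ _))//; lra.
Qed.

Lemma complex_cauchy_cvg (x : nat -> R[i]) :
  (forall e, 0 < e -> exists n0, forall N M, (n0 <= N)%N -> (n0 <= M)%N ->
     Normc.normc (x N - x M) <= e) ->
  exists l, Normc.normc (x n - l) @[n --> \oo] --> 0.
Proof.
move=> H.
have [|r xr] := @real_cauchy_cvg (fun n => complex.Re (x n)).
  move=> e /H[n0 Hn]; exists n0 => N M hN hM.
  by rewrite -raddfB (le_trans (Re_le_normc _))// Hn.
have [|s xs] := @real_cauchy_cvg (fun n => complex.Im (x n)).
  move=> e /H[n0 Hn]; exists n0 => N M hN hM.
  by rewrite -raddfB (le_trans (Im_le_normc _))// Hn.
by exists (r +i* s); exact: cvg_ReIm.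
Qed.

(** The coefficients converge one by one; letting [M] tend to infinity in the Cauchy
bound on [a N - a M] gives the bound on [a N - g], by lower semicontinuity. *)
Lemma energy_complete p (a : nat -> nat -> R[i]) : 0 < p ->
  (forall e, 0 < e -> exists n0, forall N M, (n0 <= N)%N -> (n0 <= M)%N ->
     (energy p (a N - a M)%R <= e%:E)%E) ->
  exists g, (forall n, Normc.normc (a N n - g n) @[N --> \oo] --> 0) /\
   cvg_energy p a g.
Proof.
move=> p0 H.
have /choice[g ag] : forall n, exists l, Normc.normc (a N n - l) @[N --> \oo] --> 0.
  move=> n; apply: complex_cauchy_cvg => e e0.
  have [|n0 Hn] := H (e `^ p); first by rewrite powR_gt0.
  exists n0 => N M hN hM.
  have := energy_coef n p0 (Hn N M hN hM).
  by rewrite -powRrM mulfV ?gt_eqF// powRr1// ltW.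
exists g; split=> // e /H[n0 Hn]; exists n0 => N hN.
apply: (@energy_fatou p (fun M => a N - a M) (a N - g)) => //.
  move=> n; rewrite (_ : (fun M => _) = (fun M => Normc.normc (a M n - g n))).
    exact: ag.
  apply/funext => M; rewrite -normcN; congr Normc.normc.
  by change (- ((a N n - a M n) - (a N n - g n)) = a M n - g n); ring.
by exists n0 => // M /= hM; exact: Hn.
Qed.

(** Uniform convexity turns the lower bound on the energy of midpoints into the
Cauchy property.  The index [n0] of the set of which the late [a N] are almost
minimizers may depend on the precision [e], which allows both for a single set
and for a decreasing sequence of sets. *)
Lemma minimizing_cvg p (C : nat -> set (nat -> R[i])) (a : nat -> nat -> R[i]) (mu : R) :
  1 < p -> (forall n b c, C n b -> C n c -> C n (mid b c)) ->
  (forall e, 0 < e -> exists n0,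
    (forall N, (n0 <= N)%N -> C n0 (a N) /\ (energy p (a N) <= (mu + e)%:E)%E) /\
    (forall b, C n0 b -> ((mu - e)%:E <= energy p b)%E)) ->
  exists g, (energy p g <= mu%:E)%E /\
   cvg_energy p a g.
Proof.
move=> p1 Cmid H; have p0 : 0 < p by rewrite (lt_trans ltr01).
have mu0 : 0 <= mu.
  apply/ler_addgt0Pr => e /H[n0 [/(_ n0 (leqnn _))[_ h] _]].
  by rewrite -lee_fin (le_trans (energy_ge0 _ _) h).
have [e e0|g [ag Hg]] := @energy_complete p a p0.
  (* The inequality bounds the energy of [a N - a M] by
     [2 * e1 * (mu + d) + 2 * C1 * d]; each summand is made at most [e / 2]. *)
  pose e1 := e / (4 * (mu + 1)).
  have e10 : 0 < e1 by rewrite divr_gt0//; lra.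
  have [C1 C10 uc] := energy_uniform_convexity p1 e10.
  pose d := Num.min 1 (e / (4 * (C1 + 1))).
  have d0 : 0 < d by rewrite lt_min ltr01/= divr_gt0//; lra.
  have [n0 [Hn0 Hlow]] := H d d0; exists n0 => N M /Hn0[CN aN] /Hn0[CM aM].
  have h1 : ((C1 * (mu - d))%:E <= C1%:E * energy p (mid (a N) (a M)))%E.
    by rewrite EFinM lee_wpmul2l ?lee_fin//; exact/Hlow/Cmid.
  have h2 : (energy p (a N) + energy p (a M) <= (2 * (mu + d))%:E)%E.
    by rewrite mulr_natl mulr2n EFinD leeD.
  have : (energy p (a N - a M)%R + (C1 * (mu - d))%:E <=
          ((e1 + C1 / 2) * (2 * (mu + d)))%:E)%E.
    apply: (le_trans (leeD2l _ h1)); apply: (le_trans (uc _ _)).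
    by rewrite EFinM lee_wpmul2l// lee_fin; lra.
  rewrite -leeBrDr// -EFinB => /le_trans; apply; rewrite lee_fin.
  have d1 : d <= 1 by rewrite ge_min lexx.
  have d2 : d <= e / (4 * (C1 + 1)) by rewrite ge_min lexx orbT.
  have hmu : mu + 1 != 0 by rewrite gt_eqF//; lra.
  have hC : C1 + 1 != 0 by rewrite gt_eqF//; lra.
  have h3 : e1 * (mu + d) <= e / 4.
    have <- : e1 * (mu + 1) = e / 4 by rewrite /e1; field.
    by rewrite ler_pM2l// lerD2l.
  have h4 : C1 * d <= e / 4.
    have <- : (C1 + 1) * (e / (4 * (C1 + 1))) = e / 4 by field.
    by apply: ler_pM => //; [exact: ltW|lra].
  lra.
exists g; split=> //; apply/lee_addgt0Pr => e e0.
rewrite -EFinD; apply: (@energy_fatou p a g) => //.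
have [n0 [Hn _]] := H e e0; exists n0 => // N /= hN; by have [] := Hn N hN.
Qed.

(** * Evaluation at a point of the disk *)

(** Balls in the topology of the complex plane have radii in [R[i]], a positive such
radius being a real number; this lemma replaces them by real moduli. *)
Lemma cvg_complexP (x : nat -> R[i]) y :
  (x : nat -> R[i]^o) @ \oo --> (y : R[i]^o) <->
  Normc.normc (x n - y) @[n --> \oo] --> 0.
Proof.
split => [/cvgrPdist_lt h|/cvgrPdist_lt h]; apply/cvgrPdist_lt => e e0.
  have : 0 < e%:C by rewrite ltcR.
  move=> /h; apply: filterS => n; rewrite normr_normc ltcR sub0r normrN.
  by rewrite ger0_norm ?normc_ge0// -opprB normcN.
have ee : e = (complex.Re e)%:C by rewrite RRe_real// gtr0_real.
move: e0; rewrite ee ltcR => /h; apply: filterS => n.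
rewrite normr_normc ltcR sub0r normrN.
by rewrite ger0_norm ?normc_ge0// -opprB normcN.
Qed.

Lemma normc_sum_le (x : nat -> R[i]) k :
  Normc.normc (\sum_(0 <= n < k) x n) <= \sum_(0 <= n < k) Normc.normc (x n).
Proof.
elim: k => [|k IH]; first by rewrite !big_geq// Normc.normc0.
by rewrite !big_nat_recr//= (le_trans (le_normcD _ _))// lerD2r.
Qed.

Lemma normcX x n : Normc.normc (x ^+ n) = Normc.normc x ^+ n.
Proof. by elim: n => [|n IH]; rewrite ?expr0 ?Normc.normc1// !exprS Normc.normcM IH. Qed.

Lemma normc_term_le a z B n : (forall n, Normc.normc (a n) <= B) ->
  Normc.normc (a n * z ^+ n) <= geometric B (Normc.normc z) n.
Proof.
by move=> aB; rewrite Normc.normcM normcX /= ler_wpM2r ?exprn_ge0 ?normc_ge0.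
Qed.

(** The real and imaginary parts are real series dominated by a geometric series. *)
Lemma eval_cvg a z B : Normc.normc z < 1 -> (forall n, Normc.normc (a n) <= B) ->
  series (fun n => a n * z ^+ n : R[i]^o) @ \oo --> (Defs.eval a z : R[i]^o).
Proof.
move=> z1 aB.
have B0 : 0 <= B by rewrite (le_trans _ (aB 0%N))// normc_ge0.
have real_cvg (u : nat -> R) :
    (forall n, `|u n| <= Normc.normc (a n * z ^+ n)) -> cvgn (series u).
  move=> ule; apply: normed_cvg.
  apply: (@series_le_cvg _ _ (geometric B (Normc.normc z))).
  - by move=> n; exact: normr_ge0.
  - by move=> n; rewrite /= mulr_ge0 ?exprn_ge0 ?normc_ge0.
  - by move=> n; rewrite /= (le_trans (ule n))// normc_term_le.
  - by apply: is_cvg_geometric_series; rewrite ger0_norm ?normc_ge0.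
have /cvg_ex[r hr] :=
  real_cvg (fun n => complex.Re (a n * z ^+ n)) (fun n => Re_le_normc _).
have /cvg_ex[s hs] :=
  real_cvg (fun n => complex.Im (a n * z ^+ n)) (fun n => Im_le_normc _).
have h : (series (fun n => a n * z ^+ n : R[i]^o)) @ \oo --> (r +i* s : R[i]^o).
  apply/cvg_complexP; apply: cvg_ReIm.
    by under eq_fun do rewrite /series/= raddf_sum.
  by under eq_fun do rewrite /series/= raddf_sum.
by apply/cvg_ex; exists (r +i* s).
Qed.

Lemma eval_bound a z B : Normc.normc z < 1 -> (forall n, Normc.normc (a n) <= B) ->
  Normc.normc (Defs.eval a z) <= B / (1 - Normc.normc z).
Proof.
move=> z1 aB; have B0 : 0 <= B by rewrite (le_trans _ (aB 0%N))// normc_ge0.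
have /cvg_complexP/cvg_normc h := eval_cvg z1 aB.
rewrite -(cvg_lim _ h)//; apply: limr_le; first by apply/cvg_ex; eexists; exact: h.
apply: nearW => n; rewrite (le_trans (normc_sum_le _ _))//.
apply: (@le_trans _ _ (series (geometric B (Normc.normc z)) n)).
  by rewrite /series/=; apply: ler_sum => k _; exact: normc_term_le.
rewrite geometric_seriesE ?lt_eqF//= ler_pM2r ?invr_gt0 ?subr_gt0//.
by rewrite ler_piMr// gerBl exprn_ge0// normc_ge0.
Qed.

Lemma eval_linear a b z B B' (c d : R[i]) : Normc.normc z < 1 ->
  (forall n, Normc.normc (a n) <= B) -> (forall n, Normc.normc (b n) <= B') ->
  Defs.eval (fun n => c * a n + d * b n) z = c * Defs.eval a z + d * Defs.eval b z.
Proof.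
move=> z1 aB bB.
have /cvg_complexP ha := eval_cvg z1 aB; have /cvg_complexP hb := eval_cvg z1 bB.
suff h : series (fun n => (c * a n + d * b n) * z ^+ n : R[i]^o) @ \oo -->
    (c * Defs.eval a z + d * Defs.eval b z : R[i]^o).
  exact: (cvg_lim (@norm_hausdorff _ R[i]^o) h).
apply/cvg_complexP.
pose A n := Normc.normc (series (fun n => a n * z ^+ n : R[i]^o) n - Defs.eval a z).
pose B0 n := Normc.normc (series (fun n => b n * z ^+ n : R[i]^o) n - Defs.eval b z).
apply: (@squeeze_cvgr _ _ _ _ (cst 0)
  (fun n => Normc.normc c * A n + Normc.normc d * B0 n)).
- apply: nearW => n; rewrite normc_ge0/= -!Normc.normcM.
  apply: le_trans (le_normcD _ _); rewrite le_eqVlt; apply/orP; left; apply/eqP.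
  congr Normc.normc; rewrite /series/= !mulrBr !mulr_sumr opprD addrACA -big_split.
  by congr (_ + _); apply: eq_bigr => k _; rewrite mulrDl !mulrA.
- exact: cvg_cst.
- have -> : 0 = Normc.normc c * 0 + Normc.normc d * 0 :> R by rewrite !mulr0 addr0.
  by apply: cvgD; apply: cvgM => //; exact: cvg_cst.
Qed.

Lemma normc_small_eq0 x : (forall e, 0 < e -> Normc.normc x <= e) -> x = 0.
Proof.
move=> H; apply: Normc.eq0_normc; apply/eqP; rewrite eq_le normc_ge0 andbT.
by apply/ler_addgt0Pr => e /H; rewrite add0r.
Qed.

Lemma energy_lty p a : (energy p a < +oo)%E ->
  exists2 c : R, 0 <= c & energy p a = c%:E.
Proof.
move=> ay; exists (fine (energy p a)); first by rewrite fine_ge0// energy_ge0.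
by rewrite fineK// ge0_fin_numE// energy_ge0.
Qed.

Lemma energy_bounded p a : 0 < p -> (energy p a < +oo)%E ->
  exists B, forall n, Normc.normc (a n) <= B.
Proof.
move=> p0 /energy_lty[c _ ac]; exists (c `^ p^-1) => n.
by apply: energy_coef => //; rewrite ac.
Qed.

Lemma energy_small_eq p f g : 0 < p ->
  (forall e, 0 < e -> (energy p (f - g)%R <= e%:E)%E) -> f = g.
Proof.
move=> p0 H; apply/funext => n; apply/eqP; rewrite -subr_eq0; apply/eqP.
apply: normc_small_eq0 => e e0; have := energy_coef n p0 (H (e `^ p) (powR_gt0 _ e0)).
by rewrite -powRrM mulfV ?gt_eqF// powRr1// ltW.
Qed.

Lemma energy_mid_lty p a b : 0 < p -> (energy p a < +oo)%E -> (energy p b < +oo)%E ->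
  (energy p (mid a b) < +oo)%E.
Proof.
move=> p0 ay bY; apply: (@le_lt_trans _ _ (energy p a + energy p b)%E); last first.
  exact: lte_add_pinfty.
rewrite /energy -nneseriesD; last 2 first.
- by move=> n _ _; rewrite lee_fin powR_ge0.
- by move=> n _ _; rewrite lee_fin powR_ge0.
apply: lee_nneseries => [n _ _|n _]; first by rewrite lee_fin powR_ge0.
rewrite -EFinD lee_fin /mid Normc.normcM normc_real ger0_norm ?invr_ge0//.
have := le_normcD (a n) (b n); have := normc_ge0 (a n); have := normc_ge0 (b n).
have hp := @ge0_ler_powR R p (ltW p0).
have [ab|ba] := leP (Normc.normc (a n)) (Normc.normc (b n)) => bn an abn.
  apply: (@le_trans _ _ (Normc.normc (b n) `^ p)); last by rewrite lerDr powR_ge0.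
  by apply: hp; rewrite ?nnegrE ?mulr_ge0 ?normc_ge0//; lra.
apply: (@le_trans _ _ (Normc.normc (a n) `^ p)); last by rewrite lerDl powR_ge0.
by apply: hp; rewrite ?nnegrE ?mulr_ge0 ?normc_ge0//; lra.
Qed.

(** Convergence in energy makes the coefficients of [a N - g] uniformly small, hence
also their values at [z]. *)
Lemma eval_limit p (a : nat -> nat -> R[i]) g z v n1 : 0 < p -> Normc.normc z < 1 ->
  (energy p g < +oo)%E -> (forall N, (energy p (a N) < +oo)%E) ->
  cvg_energy p a g ->
  (forall N, (n1 <= N)%N -> Defs.eval (a N) z = v) -> Defs.eval g z = v.
Proof.
move=> p0 z1 gy ay ag av; apply/eqP; rewrite -subr_eq0; apply/eqP.
apply: normc_small_eq0 => e e0.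
have d0 : 0 < 1 - Normc.normc z by rewrite subr_gt0.
have [|n0 H] := ag ((e * (1 - Normc.normc z)) `^ p); first by rewrite powR_gt0// mulr_gt0.
pose N := maxn n0 n1; rewrite -(av N) ?leq_maxr//.
have [B aB] := energy_bounded p0 (ay N); have [B' gB] := energy_bounded p0 gy.
have := eval_linear 1 (-1) z1 gB aB.
rewrite mul1r mulN1r => <-.
rewrite (_ : (fun n => _) = (fun n => - (a N n - g n))); last by apply/funext => n; ring.
apply: le_trans (eval_bound (B := e * (1 - Normc.normc z)) z1 _) _; last first.
  by rewrite mulfK// gt_eqF.
move=> n; rewrite normcN.
have := energy_coef n p0 (H N (leq_maxl _ _)).
by rewrite -powRrM mulfV ?gt_eqF// powRr1// mulr_ge0// ltW.
Qed.

(** * Interpolants of minimal norm *)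

Lemma weight_neq0 q z : 0 < q -> Normc.normc z < 1 -> weight q z != 0.
Proof.
move=> q0 z1; rewrite /weight (inj_eq (@complexI R) _ 0) gt_eqF// powR_gt0// subr_gt0.
have [->|z0] := eqVneq (Normc.normc z) 0; first by rewrite powR0 ?gt_eqF.
have -> : 1 = 1 `^ q :> R by rewrite powR1.
by apply: gt0_ltr_powR; rewrite ?nnegrE ?normc_ge0.
Qed.

Lemma mulf_eq_divl (w x c : R[i]) : w != 0 -> (w * x = c) <-> (x = c / w).
Proof.
move=> w0; split => [<-|->]; first by rewrite mulrAC mulfV// mul1r.
by rewrite mulrCA mulfV// mulr1.
Qed.

Section interp.
Variables (p q : R) (Z : nat -> R[i]) (j : nat).
Hypotheses (p1 : 1 < p) (q0 : 0 < q) (Zlt1 : forall k, Normc.normc (Z k) < 1).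
Hypothesis Zinj : injective Z.
Local Notation C := (interpolants p q Z j).

Let p0 : 0 < p. Proof. exact: lt_trans ltr01 p1. Qed.

Lemma interpolants_mid K a b : C K a -> C K b -> C K (mid a b).
Proof.
move=> [/(lpAE _ p0) ay aj aK] [/(lpAE _ p0) bY bj bK].
have [B aB] := energy_bounded p0 ay; have [B' bB] := energy_bounded p0 bY.
have W k : weight q (Z k) * Defs.eval (mid a b) (Z k) =
    (2^-1)%:C * (weight q (Z k) * Defs.eval a (Z k) +
                 weight q (Z k) * Defs.eval b (Z k)).
  have -> : mid a b = (fun n => (2^-1)%:C * a n + (2^-1)%:C * b n).
    by apply/funext => n; rewrite /mid; ring.
  by rewrite (eval_linear _ _ (Zlt1 k) aB bB); ring.
split; first by apply/(lpAE _ p0); exact: energy_mid_lty.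
  rewrite W aj bj; apply/eqP; rewrite eq_complex/=; apply/andP; split; apply/eqP; lra.
by move=> k Kk kj; rewrite W aK// bK// addr0 mulr0.
Qed.

(** The node sets [Ks N] may vary with [N]: an interpolation condition survives in the
limit as soon as it holds for all large [N]. *)
Lemma interpolants_limit K (Ks : nat -> set nat) (a : nat -> nat -> R[i]) g :
  (forall N, C (Ks N) (a N)) ->
  (forall k, K k -> exists n0, forall N, (n0 <= N)%N -> Ks N k) ->
  (energy p g < +oo)%E ->
  cvg_energy p a g ->
  C K g.
Proof.
move=> Ca hK gy ag.
have ay N : (energy p (a N) < +oo)%E by apply/(lpAE _ p0); have [] := Ca N.
have L k c n1 :
    (forall N, (n1 <= N)%N -> weight q (Z k) * Defs.eval (a N) (Z k) = c) ->
    weight q (Z k) * Defs.eval g (Z k) = c.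
  have w0 := weight_neq0 q0 (Zlt1 k).
  move=> H; apply/(mulf_eq_divl _ _ w0).
  apply: (eval_limit p0 (Zlt1 k) gy ay ag (n1 := n1)) => N /H.
  by move/(mulf_eq_divl _ _ w0).
split; first exact/(lpAE _ p0).
  by apply: (L _ _ 0%N) => N _; have [] := Ca N.
move=> k /hK[n0 H] kj; apply: (L _ _ n0) => N /H NK; have [_ _] := Ca N; exact.
Qed.

Lemma min_norm_exists K : C K !=set0 -> exists f, min_norm p (C K) f.
Proof.
move=> [a0 Ca0].
have fin a : C K a -> exists2 c : R, 0 <= c & energy p a = c%:E.
  by move=> [/(lpAE _ p0) ay _ _]; exact: energy_lty.
pose E := [set fine (energy p b) | b in C K].
have Einf : has_inf E.
  split; first by exists (fine (energy p a0)), a0.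
  by exists 0 => _ [b _ <-]; rewrite fine_ge0// energy_ge0.
pose mu := inf E.
have low b : C K b -> (mu%:E <= energy p b)%E.
  move=> Cb; have [c c0 bc] := fin b Cb; rewrite bc lee_fin.
  by apply: ge_inf; [case: Einf|exists b => //; rewrite bc].
have /choice[a Ha] : forall N : nat,
    exists a, C K a /\ (energy p a <= (mu + N.+1%:R^-1)%:E)%E.
  move=> N; have [|_ [b Cb <-] h] := @inf_adherent _ E N.+1%:R^-1 _ Einf.
    by rewrite invr_gt0.
  exists b; split=> //; have [c c0 bc] := fin b Cb.
  by move: h; rewrite bc lee_fin /= => /ltW.
have [|e e0|g [gmu ag]] := minimizing_cvg (C := fun _ => C K) (a := a) (mu := mu) p1.
- by move=> _ b c; exact: interpolants_mid.
- have [n0 hn0] : exists n0 : nat, n0.+1%:R^-1 <= e.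
    exists (Num.truncn e^-1); rewrite invf_ple ?posrE//; exact/ltW/truncnS_gt.
  exists n0; split=> [N hN|b Cb]; last first.
    by rewrite (le_trans _ (low b Cb))// lee_fin gerBl ltW.
  have [CN aN] := Ha N; split=> //; apply: (le_trans aN); rewrite lee_fin lerD2l.
  by apply: le_trans hn0; rewrite lef_pV2 ?posrE// ler_nat.
exists g; split.
  apply: (@interpolants_limit K (fun _ => K) a) => //; first by move=> N; have [] := Ha N.
    by move=> k Kk; exists 0%N.
  by rewrite (le_lt_trans gmu)// ltry.
by move=> b Cb; rewrite le_lpnorm// (le_trans gmu)// low.
Qed.

(** The sequence alternating between [f] and [g] is minimizing, hence converges, and
its limit must be both [f] and [g]. *)
Lemma min_norm_unique K f g : min_norm p (C K) f -> min_norm p (C K) g -> f = g.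
Proof.
move=> [Cf mf] [Cg mg].
have [/(lpAE _ p0)/energy_lty[c c0 fc] _ _] := Cf.
have fg : energy p f = energy p g by apply/eqP; rewrite eq_le -!le_lpnorm// mf// mg.
have [|e e0|h [_ H]] := minimizing_cvg (C := fun _ => C K)
    (a := fun N => if odd N then f else g) (mu := c) p1.
- by move=> _ a b; exact: interpolants_mid.
- exists 0%N; split => [N _|b Cb].
    by case: odd; rewrite -?fg fc lee_fin lerDl; split=> //; exact: ltW.
  by rewrite (@le_trans _ _ (energy p f))// -?le_lpnorm ?mf// fc lee_fin gerBl ltW.
transitivity h; last symmetry; apply: energy_small_eq p0 _ => e /H[n0 Hn].
  by have := Hn n0.*2.+1; rewrite /= odd_double/=; apply; rewrite -addnn -addSn leq_addl.
by have := Hn n0.*2; rewrite odd_double/=; apply; rewrite -addnn leq_addl.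
Qed.

Lemma eval_poly (P : {poly R[i]}) z : Defs.eval (fun n => P`_n) z = P.[z].
Proof.
suff h : series (fun n => P`_n * z ^+ n : R[i]^o) @ \oo --> (P.[z] : R[i]^o).
  exact: (cvg_lim (@norm_hausdorff _ R[i]^o) h).
apply: cvg_near_cst; exists (size P) => // n /= hn.
by rewrite /series/= (horner_coef_wide _ hn) big_mkord.
Qed.

Lemma energy_poly (P : {poly R[i]}) : (energy p (fun n => P`_n) < +oo)%E.
Proof.
apply: (@le_lt_trans _ _ (\sum_(0 <= n < size P) Normc.normc (P`_n) `^ p)%:E);
  last exact: ltry.
apply: lime_le; first by apply: is_cvg_nneseries => n _ _; rewrite lee_fin powR_ge0.
exists (size P) => // n /= hn.
rewrite sumEFin lee_fin (big_cat_nat _ hn)//= gerDl big_nat big1// => k /andP[hk _].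
by rewrite nth_default// Normc.normc0 powR0// gt_eqF.
Qed.

(** A multiple of the polynomial vanishing at the nodes [Z k] with [k <= N] and
[k <> j]. *)
Lemma interpolants_nonempty N : C [set k | (k <= N)%N] !=set0.
Proof.
pose s := [seq Z k | k <- [seq k <- iota 0 N.+1 | k != j]].
pose P : {poly R[i]} := \prod_(z <- s) ('X - z%:P).
have Pj : P.[Z j] != 0.
  rewrite -/(root P (Z j)) root_prod_XsubC; apply/mapP => -[k].
  by rewrite mem_filter => /andP[kj _] /Zinj jk; rewrite jk eqxx in kj.
have w0 := weight_neq0 q0 (Zlt1 j).
pose Q := (weight q (Z j) * P.[Z j])^-1 *: P.
exists (fun n => Q`_n); split.
- by apply/(lpAE _ p0); exact: energy_poly.
- by rewrite eval_poly hornerZ; field; rewrite w0 Pj.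
- move=> k /= kN /eqP kj; rewrite eval_poly hornerZ.
  have /rootP -> : root P (Z k); last by rewrite !mulr0.
  by rewrite root_prod_XsubC map_f// mem_filter kj mem_iota.
Qed.

Local Notation "'a_" := (fjN p q Z j).

Lemma fjN_min_norm N : min_norm p (C [set k | (k <= N)%N]) ('a_ N).
Proof. by apply: xgetPex; apply: min_norm_exists; exact: interpolants_nonempty. Qed.

Lemma interpolants_sub (K K' : set nat) : K `<=` K' -> C K' `<=` C K.
Proof. by move=> KK' a [ay aj aK]; split=> // k /KK' ? ?; exact: aK. Qed.

Lemma energy_fjN_le N b : C [set k | (k <= N)%N] b ->
  (energy p ('a_ N) <= energy p b)%E.
Proof. by move=> Cb; have [_ /(_ b Cb)] := fjN_min_norm N; rewrite le_lpnorm. Qed.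

Lemma energy_fjN_mono :
  {homo (fun N => energy p ('a_ N)) : n m / (n <= m)%N >-> (n <= m)%E}.
Proof.
move=> n m nm; apply: energy_fjN_le; have [Cm _] := fjN_min_norm m.
by apply: interpolants_sub Cm => k /= kn; exact: leq_trans nm.
Qed.

(** The [f_{j,N}] are almost minimal, for large [N], in each of the decreasing sets of
interpolants; the common value [mu] is the supremum of their energies. *)
Lemma bounded_fjN_cvg (c : R) : (forall N, (energy p ('a_ N) <= c%:E)%E) ->
  exists f, is_fj p q Z j f /\ cvg_energy p 'a_ f.
Proof.
move=> ac.
have fin N : exists2 x : R, 0 <= x & energy p ('a_ N) = x%:E.
  by apply: energy_lty; rewrite (le_lt_trans (ac N))// ltry.
pose E := range (fun N => fine (energy p ('a_ N))).
have Esup : has_sup E.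
  split; first by exists (fine (energy p ('a_ 0))), 0%N.
  exists c => _ [N _ <-]; have [x x0 xE] := fin N.
  by have := ac N; rewrite xE lee_fin.
pose mu := sup E.
have amu N : (energy p ('a_ N) <= mu%:E)%E.
  have [x x0 xE] := fin N; rewrite xE lee_fin; apply: ub_le_sup; first by case: Esup.
  by exists N; rewrite ?xE.
have [n b d|e e0|f [fmu af]] := minimizing_cvg (C := fun N => C [set k | (k <= N)%N])
    (a := 'a_) (mu := mu) p1.
- exact: interpolants_mid.
- have [_ [n0 _ <-] h] := sup_adherent e0 Esup; exists n0; split => [N hN|b Cb].
    split; last by rewrite (le_trans (amu N))// lee_fin lerDl ltW.
    have [CN _] := fjN_min_norm N.
    by apply: interpolants_sub CN => k /= kn; exact: leq_trans hN.
  apply: le_trans (energy_fjN_le Cb); have [x x0 xE] := fin n0.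
  by move: h; rewrite xE lee_fin => /ltW.
exists f; split=> //; split.
  apply: (interpolants_limit (Ks := fun N => [set k | (k <= N)%N]) (a := 'a_)) => //.
  - by move=> N; have [] := fjN_min_norm N.
  - by move=> k _; exists k.
  - by rewrite (le_lt_trans fmu)// ltry.
move=> b Cb; rewrite le_lpnorm// (le_trans fmu)//.
have [/(lpAE _ p0)/energy_lty[x x0 xE] _ _] := Cb.
rewrite xE lee_fin; apply: ge_sup; first by exists (fine (energy p ('a_ 0))), 0%N.
move=> _ [N _ <-]; have [y y0 yE] := fin N.
rewrite -lee_fin yE /= -yE -xE; apply: energy_fjN_le.
exact: interpolants_sub Cb.
Qed.

End interp.

End S.

Theorem theorem4p6 (R : realType) (p q : R) (Z : nat -> R[i])
  (hp : 1 < p) (hpq : p^-1 + q^-1 = 1)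
  (Z_inj : injective Z) (Z_neq0 : forall k, Z k != 0)
  (Z_disk : forall k, Normc.normc (Z k) < 1) (j : nat) :
  [/\ cvgn (fun N => lpnorm p (fjN p q Z j N)),
      (exists f, is_fj p q Z j f) <->
        (limn (fun N => lpnorm p (fjN p q Z j N)) < +oo)%E &
      forall f, is_fj p q Z j f ->
        lpnorm p (fjN p q Z j N - f) @[N --> \oo] --> 0%E].
Proof.
have p0 : 0 < p by exact: lt_trans ltr01 hp.
have q0 : 0 < q.
  rewrite -invr_gt0; have -> : q^-1 = 1 - p^-1 by rewrite -hpq addrC addKr.
  by rewrite subr_gt0 invf_lt1.
have lmono :
    {homo (fun N => lpnorm p (fjN p q Z j N)) : n m / (n <= m)%N >-> (n <= m)%E}.
  move=> n m nm; rewrite le_lpnorm//.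
  exact: (energy_fjN_mono j hp q0 Z_disk Z_inj nm).
have lcvg := ereal_nondecreasing_is_cvgn lmono.
have le_fj f N : is_fj p q Z j f -> (lpnorm p (fjN p q Z j N) <= lpnorm p f)%E.
  move=> [Cf _]; rewrite le_lpnorm//; apply: energy_fjN_le => //.
  exact: interpolants_sub Cf.
split=> //.
- split=> [[f fP]|Loo].
    have [[fy _ _] _] := fP; apply: le_lt_trans fy.
    by apply: lime_le => //; apply: nearW => N; exact: le_fj.
  pose L := limn (fun N => lpnorm p (fjN p q Z j N)).
  have aL N : (lpnorm p (fjN p q Z j N) <= L)%E.
    have := ereal_nondecreasing_cvgn lmono; rewrite /L => /cvg_lim -> //.
    by apply: ereal_sup_ubound; exists N.
  have L0 : (0 <= L)%E by rewrite (le_trans _ (aL 0%N))// poweR_ge0.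
  have LE : L = (fine L)%:E by rewrite fineK// ge0_fin_numE.
  suff aB N : (energy p (fjN p q Z j N) <= (fine L `^ p)%:E)%E.
    by have [f [fP _]] := bounded_fjN_cvg hp q0 Z_disk Z_inj aB; exists f.
  rewrite -poweR_EFin -LE -(lpnormK _ p0); apply: gt0_ler_poweR => //; first exact: ltW.
    by rewrite in_itv/= leey andbT poweR_ge0.
  by rewrite in_itv/= leey andbT.
move=> f fP; have [[fy _ _] _] := fP.
have [c c0 fc] := energy_lty (iffLR (lpAE _ p0) fy).
have aB N : (energy p (fjN p q Z j N) <= c%:E)%E.
  by rewrite -fc -le_lpnorm//; exact: le_fj.
have [g [gP ag]] := bounded_fjN_cvg hp q0 Z_disk Z_inj aB.
rewrite (min_norm_unique hp Z_disk fP gP).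
have small e : 0 < e -> exists n0, forall N, (n0 <= N)%N ->
    (lpnorm p (fjN p q Z j N - g)%R <= e%:E)%E.
  move=> e0; have [|n0 H] := ag (e `^ p); first by rewrite powR_gt0.
  exists n0 => N /H h.
  have -> : e%:E = ((e `^ p)%:E `^ p^-1)%E.
    by rewrite poweR_EFin -powRrM mulfV ?gt_eqF// powRr1// ltW.
  apply: gt0_ler_poweR => //; first by rewrite invr_ge0 ltW.
    by rewrite in_itv/= leey andbT energy_ge0.
  by rewrite in_itv/= leey andbT lee_fin powR_ge0.
apply/fine_cvgP; split.
  have [n0 H] := small 1 ltr01; exists n0 => // N /= /H h.
  by rewrite ge0_fin_numE ?poweR_ge0// (le_lt_trans h)// ltry.
apply/cvgrPdist_le => e e0; have [n0 H] := small e e0; exists n0 => // N /= /H h.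
rewrite sub0r normrN ger0_norm ?fine_ge0 ?poweR_ge0// -lee_fin fineK//.
by rewrite ge0_fin_numE ?poweR_ge0// (le_lt_trans h)// ltry.
Qed.
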